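(* Let $X$ be a metric space and let $(Z,\lambda)$ be a metric equiconnected space such that $\lambda$ is Lipschitz with respect to the third variable and $Z$ is an absolute extensor for $X$. Let $g:X\to Z$ be a mapping. Then the following conditions are equivalent: (i) $g\in B_1^d(X,Z)$; (ii) there exists a mapping $f:X^2\to Z$ with the diagonal $g$ (i.e. $f(x,x)=g(x)$ for every $x\in X$) which is continuous with respect to the first variable and Lipschitz with respect to the second one; (iii) there exists a mapping $f:X^2\to Z$ with the diagonal $g$ which is continuous with respect to the first variable and pointwise Lipschitz with respect to the second variable at every point of the diagonal $\Delta=\{(x,x):x\in X\}$.
   Context: The metric of a metric space $X$ is denoted $|\cdot-\cdot|_X$. An equiconnected space is a pair $(Z,\lambda)$ consisting of a topological space $Z$ and a continuous function $\lambda:Z\times Z\times[0,1]\to Z$ such that $\lambda(x,y,0)=x$, $\lambda(x,y,1)=y$ and $\lambda(x,x,t)=x$ for all $x,y\in Z$ and $t\in[0,1]$. It is a metric equiconnected space if $Z$ is a metric space (with the metric topology). A mapping $h:X\to Z$ between metric spaces is Lipschitz if $\sup_{x\ne y}\frac{|h(x)-h(y)|_Z}{|x-y|_X}<\infty$; it is Lipschitz at a point $x\in X$ if $\sup_{y\in X,\,y\ne x}\frac{|h(x)-h(y)|_Z}{|x-y|_X}<\infty$. ''$\lambda$ is Lipschitz with respect to the third variable'' means that for all $x,y\in Z$ the mapping $t\mapsto\lambda(x,y,t)$, $[0,1]\to Z$, is Lipschitz. For $f:X^2\to Z$: continuous with respect to the first variable means that $x\mapsto f(x,y)$ is continuous for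 every $y\in X$; Lipschitz with respect to the second variable means that $y\mapsto f(x,y)$ is Lipschitz for every $x\in X$ (the constant may depend on $x$); pointwise Lipschitz with respect to the second variable at every point of $\Delta$ means that for every $x\in X$ the mapping $y\mapsto f(x,y)$ is Lipschitz at the point $y=x$. $Z$ is an absolute extensor for $X$ if for every closed set $A\subseteq X$ every continuous mapping $A\to Z$ extends to a continuous mapping $X\to Z$. $B_1^d(X,Z)$ (the stable first Baire class) is the collection of all mappings $g:X\to Z$ for which there is a sequence of continuous mappings $g_n:X\to Z$ that converges pointwise stably to $g$: for every $x\in X$ there is $n_0\in\mathbb N$ with $g_n(x)=g(x)$ for all $n>n_0$. *)

(* Defs.v *)
From HB Require Import structures.
From mathcomp Require Import all_boot all_order all_algebra.
From mathcomp Require Import all_classical all_reals all_analysis.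

Set Implicit Arguments.
Unset Strict Implicit.
Unset Printing Implicit Defensive.

Import Order.TTheory GRing.Theory Num.Theory.
Import numFieldNormedType.Exports.

Local Open Scope classical_set_scope.
Local Open Scope ring_scope.

(* [lambda] is only constrained on [Z * Z * [0, 1]]; its values at third
   coordinates outside [0, 1] are irrelevant. *)
Definition equiconnected (R : realType) (Z : topologicalType)
    (lambda : Z * Z * R -> Z) : Prop :=
  [/\ {within [set: Z * Z] `*` `[0, 1], continuous lambda},
      forall x y, lambda (x, y, 0) = x,
      forall x y, lambda (x, y, 1) = y &
      forall x t, t \in `[0, 1] -> lambda (x, x, t) = x].

(* For [h] as a mapping on the subspace [A]; the supremum of the difference
   quotients is finite iff they are bounded above. *)
Definition lipschitz_within (R : realType) (X Z : metricType R) (A : set X)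
    (h : X -> Z) : Prop :=
  has_ubound [set r : R | exists x y,
    [/\ A x, A y, x <> y & r = mdist (h x) (h y) / mdist x y]].

Definition lipschitz_map (R : realType) (X Z : metricType R)
    (h : X -> Z) : Prop :=
  lipschitz_within [set: X] h.

(* [y] ranges over the whole space, not just over a neighbourhood of [x]. *)
Definition lipschitz_at (R : realType) (X Z : metricType R)
    (h : X -> Z) (x : X) : Prop :=
  has_ubound [set r : R | exists y,
    y <> x /\ r = mdist (h x) (h y) / mdist x y].

(* [R^o] carries the metric |s - t| on the scalars. *)
Definition lipschitz_third (R : realType) (Z : metricType R)
    (lambda : Z * Z * R -> Z) : Prop :=
  forall x y, @lipschitz_within R R^o Z `[0, 1] (fun t => lambda (x, y, t)).

(* The type of [h] is the subtype of [X] attached to [A], with the subspace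
   topology. *)
Definition absolute_extensor (Z X : topologicalType) : Prop :=
  forall A : set X, closed A ->
  forall h : A -> Z, continuous h ->
  exists2 H : X -> Z, continuous H & forall a : A, H (\val a) = h a.

Definition stable_baire1 (X Z : topologicalType) (g : X -> Z) : Prop :=
  exists2 g_ : nat -> X -> Z, (forall n, continuous (g_ n)) &
    forall x, exists n0, forall n, (n0 < n)%N -> g_ n x = g x.

Definition has_diagonal (X Z : Type) (f : X * X -> Z) (g : X -> Z) : Prop :=
  forall x, f (x, x) = g x.

Definition continuous_first (X Z : topologicalType) (f : X * X -> Z) : Prop :=
  forall y, continuous (fun x => f (x, y)).

Definition lipschitz_second (R : realType) (X Z : metricType R)
    (f : X * X -> Z) : Prop :=
  forall x, lipschitz_map (fun y => f (x, y)).

Definition lipschitz_second_at_diagonal (R : realType) (X Z : metricType R)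
    (f : X * X -> Z) : Prop :=
  forall x, lipschitz_at (fun y => f (x, y)) x.

(* Main.v *)
(** (iii) => (i): let [A n] be the set of the [x] with
    [|g x - f (x, y)| <= n |x - y|] for all [y]. If [y] tends to [x] in [A n],
    then [g y] is close to [f (y, x)], which tends to [f (x, x) = g x] by
    continuity in the first variable. Hence [g] is continuous on the closures
    of the [A n]; they increase to [X], and the continuous extensions of the
    restrictions of [g] to them converge stably to [g].

    (i) => (ii): concatenating the [lambda]-paths from [g_ k x] to [g_ k.+1 x]
    gives a jointly continuous [F x s], Lipschitz in [s], which is constant
    and equal to [g x] for [s >= N x], where [N x] is the index from which
    [g_ n x] is stationary. It remains to take [f (x, y) = F x (phi (x, y))]
    for a real function [phi] with diagonal [N], continuous in [x] and
    Lipschitz in [y]. As [N] is lower semicontinuous and integer-valued, it has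
    a local minimum at every point, so that the inf-convolution of [N] with
    [k |x - z|], taken at [k = |x - y| ^ (- 1 / 2)], is equal to [N x] for [y]
    close to [x], while it is at most [N y + |x - y| ^ (1 / 2)]. *)
Require Import Defs.
From HB Require Import structures.
From mathcomp Require Import all_boot all_order all_algebra.
From mathcomp Require Import all_classical all_reals all_analysis.
From mathcomp Require Import ring lra.

Set Implicit Arguments.
Unset Strict Implicit.
Unset Printing Implicit Defensive.

Import Order.TTheory GRing.Theory Num.Theory.
Import numFieldNormedType.Exports.
Import metricType_numDomainType.

Local Open Scope classical_set_scope.
Local Open Scope ring_scope.

(** * Pointwise Lipschitz maps and stable convergence *)

Lemma lipschitz_withinP (R : realType) (X Z : metricType R) (A : set X)
    (h : X -> Z) :
  lipschitz_within A h <->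
  exists2 L : R, 0 <= L &
    forall x y, A x -> A y -> mdist (h x) (h y) <= L * mdist x y.
Proof.
split=> [[M ubM]|[L L0 hL]]; last first.
  exists L => _ [x [y [Ax Ay xy ->]]]; rewrite ler_pdivrMr ?hL//.
  by rewrite mdist_gt0; exact/eqP.
(* If [A] has at most one point there are no quotients, and [M] may be negative. *)
exists (Num.max 0 M); first by rewrite le_max lexx.
move=> x y Ax Ay; have [->|/eqP xy] := eqVneq x y; first by rewrite !mdistxx mulr0.
rewrite -ler_pdivrMr ?mdist_gt0; last exact/eqP.
by rewrite le_max ubM ?orbT//; exists x, y.
Qed.

(* Regularity of [Z] upgrades limits along [A] to limits along its closure. *)
Lemma continuous_within_closure (R : realType) (X : topologicalType)
    (Z : metricType R) (A : set X) (g : X -> Z) :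
  (forall x, closure A x -> g y @[y --> within A (nbhs x)] --> g x) ->
  {within closure A, continuous g}.
Proof.
move=> gA; apply/subspace_continuousP => x Ax; apply/cvgrPdist_lt => e e0.
have e20 : 0 < e / 2 by rewrite divr_gt0.
have /cvgrPdist_lt/(_ _ e20) := gA x Ax.
rewrite near_withinE => /nbhs_interior; rewrite !near_simpl /=.
rewrite /within /=; apply: filterS => w wx Aw.
have /cvgrPdist_lt/(_ _ e20) := gA w Aw; rewrite near_withinE => gw.
(* [y] in [A] is taken so close to [w] that [g y] is near both [g w] and [g x]. *)
have [y [Ay [xy wy]]] := Aw _ (filterI wx gw).
rewrite (le_lt_trans (metric_triangle _ (g y) _))// (splitr e) ltrD ?xy//.
by rewrite metric_sym wy.
Qed.

Lemma stable_baire1_of_closed_cover (X Z : topologicalType) (A : nat -> set X)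
    (g : X -> Z) :
  absolute_extensor Z X ->
  (forall m n, (m <= n)%N -> A m `<=` A n) -> (forall x, exists n, A n x) ->
  (forall n, closed (A n)) -> (forall n, {within A n, continuous g}) ->
  stable_baire1 g.
Proof.
move=> ae Aincr Acov Acl gA.
have /choice[g_ g_P] n : exists h : X -> Z,
    continuous h /\ forall x, A n x -> h x = g x.
  have [|h hc hE] := ae (A n) (Acl n) (sigL (A n) g).
    exact/subspace_sigL_continuousP.
  by exists h; split=> // x /mem_set Ax; have := hE (exist _ x Ax).
exists g_ => [n|x]; first by have [] := g_P n.
have [n An] := Acov x; exists n => m nm.
by have [_ ->//] := g_P m; apply: Aincr An; exact: ltnW.
Qed.

Lemma stable_baire1_diagonal (R : realType) (X Z : metricType R)
    (f : X * X -> Z) (g : X -> Z) :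
  absolute_extensor Z X -> has_diagonal f g -> continuous_first f ->
  lipschitz_second_at_diagonal f -> stable_baire1 g.
Proof.
move=> ae fg fc fl.
pose A (n : nat) := [set x | forall y, mdist (g x) (f (x, y)) <= n%:R * mdist x y].
have Aincr m n : (m <= n)%N -> A m `<=` A n.
  move=> mn x /= + y => /(_ y) /le_trans; apply.
  by rewrite ler_wpM2r ?mdist_ge0// ler_nat.
apply: (@stable_baire1_of_closed_cover _ _ (closure \o A)) => //=.
- by move=> m n mn; apply: closureS; exact: Aincr.
- move=> x; have [M ubM] := fl x; exists (Num.truncn M).+1; apply: subset_closure.
  move=> y /=; have [->|xy] := eqVneq y x; first by rewrite fg !mdistxx mulr0.
  rewrite -ler_pdivrMr ?mdist_gt0 1?eq_sym//.
  rewrite (le_trans _ (ltW (truncnS_gt _)))//.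
  by apply: ubM; exists y; split; [exact/eqP|rewrite fg].
- by move=> n; exact: closed_closure.
move=> n; apply: continuous_within_closure => x Ax; apply/cvgrPdist_lt => e e0.
rewrite near_withinE; near=> y => Ay.
rewrite -(fg x) (le_lt_trans (metric_triangle _ (f (y, x)) _))// (splitr e) ltrD//.
  near: y; have /cvgrPdist_lt := fc x x; apply; exact: divr_gt0.
rewrite metric_sym (le_lt_trans (Ay x))// metric_sym.
(* [n] may be [0]; passing to [n.+1] allows the division that gives the radius. *)
rewrite (@le_lt_trans _ _ (n.+1%:R * mdist x y))//.
  by rewrite ler_wpM2r ?mdist_ge0// ler_nat.
rewrite mulrC -ltr_pdivlMr//; near: y; apply/nbhs_mdistP.
by exists (e / 2 / n.+1%:R) => //=; rewrite !divr_gt0.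
Unshelve. all: by end_near. Qed.

(** * Inf-convolution with a multiple of the distance *)

Lemma continuous_mdistl (R : realType) (X : metricType R) (y : X) :
  continuous (fun x => mdist x y : R).
Proof.
move=> x; apply/(@cvgrPdist_lt R R^o) => e e0; apply/nbhs_mdistP.
exists e => //= z xz; apply: le_lt_trans xz; rewrite [leLHS]/mdist/= ler_norml.
rewrite lerNl opprB !lerBlDr metric_triangle andTb.
by rewrite -{1}(metric_sym z x) metric_triangle.
Qed.

(** When [N] and [k] are nonnegative, this is the Pasch-Hausdorff envelope, the greatest
    [k]-Lipschitz minorant of [N]. *)
Definition inf_conv (R : realType) (X : metricType R) (N : X -> R) (k : R)
    (x : X) : R :=
  inf (range (fun z => N z + k * mdist x z)).

Section inf_conv.
Context (R : realType) (X : metricType R) (N : X -> R).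
Hypothesis N0 : forall x, 0 <= N x.

Local Notation H := (inf_conv N).

Lemma inf_conv_le k x z : 0 <= k -> H k x <= N z + k * mdist x z.
Proof.
move=> k0; apply: ge_inf; last by exists z.
by exists 0 => _ [w _ <-]; rewrite addr_ge0// mulr_ge0// mdist_ge0.
Qed.

Lemma le_inf_conv k x a : (forall z, a <= N z + k * mdist x z) -> a <= H k x.
Proof.
move=> aN; apply: lb_le_inf => [|_ [z _ <-]//].
by exists (N x + k * mdist x x), x.
Qed.

Lemma inf_conv_ge0 k x : 0 <= k -> 0 <= H k x.
Proof.
by move=> k0; apply: le_inf_conv => z; rewrite addr_ge0// mulr_ge0// mdist_ge0.
Qed.

Lemma inf_conv_self k x : 0 <= k -> H k x <= N x.
Proof. by move=> /(inf_conv_le x x); rewrite mdistxx mulr0 addr0. Qed.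

Lemma inf_conv_lipschitz k x y : 0 <= k -> H k x <= H k y + k * mdist x y.
Proof.
move=> k0; rewrite -lerBlDr; apply: le_inf_conv => z; rewrite lerBlDr.
rewrite (le_trans (inf_conv_le x z k0))// -addrA lerD2l -mulrDr ler_wpM2l//.
by rewrite addrC metric_triangle.
Qed.

Lemma inf_conv_mono k k' x : 0 <= k -> k <= k' -> H k x <= H k' x.
Proof.
move=> k0 kk'; apply: le_inf_conv => z; apply: le_trans (inf_conv_le x z k0) _.
by rewrite lerD2l ler_wpM2r// mdist_ge0.
Qed.

(** As [k' / k >= 1] and [N z >= 0], multiplying [N z + k * mdist x z] by [k' / k] gives at least
    [N z + k' * mdist x z]. Together with monotonicity, this controls the dependence on [k]. *)
Lemma inf_conv_scale k k' x : 0 < k -> k <= k' -> H k' x <= k' / k * H k x.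
Proof.
move=> k0 kk'; have k'0 : 0 < k' by exact: lt_le_trans kk'.
rewrite -ler_pdivrMl ?divr_gt0//; apply: le_inf_conv => z.
rewrite ler_pdivrMl ?divr_gt0//.
apply: le_trans (inf_conv_le x z (ltW k'0)) _.
rewrite mulrDr mulrA divfK ?gt_eqF// lerD2r ler_peMl//.
by rewrite ler_pdivlMr// mul1r.
Qed.

Lemma inf_conv_continuous_scale x k : 0 < k -> {for k, continuous (H ^~ x)}.
Proof.
move=> k0; have hc : l / k @[l --> k] --> k / k.
  by apply: cvgM; [exact: cvg_id|exact: cvg_cst].
(* On either side of [k], one bound comes from [inf_conv_mono] and the other from
   [inf_conv_scale]. *)
apply: (squeeze_cvgr (f := fun l => Num.min 1 (l / k) * H k x)
  (h := fun l => Num.max 1 (l / k) * H k x)).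
- near=> l; have l0 : 0 < l by near: l; exact: lt_nbhsr.
  have h0 := inf_conv_ge0 x (ltW k0).
  have [kl|/ltW lk] := leP k l.
    rewrite min_l ?max_r ?ler_pdivlMr ?mul1r//.
    by rewrite inf_conv_mono ?inf_conv_scale// ltW.
  rewrite min_r ?max_l ?ler_pdivrMr ?mul1r//.
  rewrite inf_conv_mono ?(ltW l0)// andbT.
  rewrite -ler_pdivlMl ?divr_gt0// invf_div.
  exact: inf_conv_scale.
- have hm : {for k, continuous (fun l : R => Num.min 1 (l / k))}.
    by apply: (@continuous_min R R (cst 1) (fun l : R => l / k)) => //;
      exact: cvg_cst.
  have : Num.min 1 (l / k) * H k x @[l --> k] --> Num.min 1 (k / k) * H k x.
    by apply: cvgM; [exact: hm|exact: cvg_cst].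
  by rewrite divff ?gt_eqF// minxx mul1r.
- have hm : {for k, continuous (fun l : R => Num.max 1 (l / k))}.
    by apply: (@continuous_max R R (cst 1) (fun l : R => l / k)) => //;
      exact: cvg_cst.
  have : Num.max 1 (l / k) * H k x @[l --> k] --> Num.max 1 (k / k) * H k x.
    by apply: cvgM; [exact: hm|exact: cvg_cst].
  by rewrite divff ?gt_eqF// maxxx mul1r.
Unshelve. all: by end_near. Qed.

(** For [y] within [r / 2] of [x], the points closer than [r / 2] to [y] lie in the ball where [N x]
    is minimal; at the others the penalty alone exceeds [N x]. *)
Lemma inf_conv_large x : (\forall z \near x, N x <= N z) ->
  exists2 K, 0 < K &
    \forall y \near x, forall k, K <= k -> N x <= H k y.
Proof.
move=> /nbhs_mdistP[r /= r0 rN].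
(* The added [1] keeps this positive when [N x = 0]. *)
have K0 : 0 < (N x + 1) / (r / 2).
  by rewrite divr_gt0 ?divr_gt0// ltr_wpDl.
exists ((N x + 1) / (r / 2)) => //.
apply/nbhs_mdistP; exists (r / 2) => /= [|y xy k Kk]; first exact: divr_gt0.
apply: le_inf_conv => z; have k0 := lt_le_trans K0 Kk.
have [yz|yz] := ltP (mdist y z) (r / 2).
  apply: (@le_trans _ _ (N z)); last first.
    by rewrite lerDl mulr_ge0 ?mdist_ge0// ltW.
  apply: rN => /=; apply: le_lt_trans (metric_triangle _ y _) _.
  by rewrite (splitr r) ltrD.
rewrite (@le_trans _ _ (k * (r / 2)))//; last first.
  by rewrite (le_trans (ler_wpM2l (ltW k0) yz))// lerDr.
by rewrite -ler_pdivrMr ?divr_gt0// (le_trans _ Kk)//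
  ler_pM2r ?invr_gt0 ?divr_gt0// lerDl.
Qed.

(** * Extension of [N] off the diagonal *)

(* At [y = x] the inverse below is the junk value [0], hence the case split. *)
Definition lsc_extension (p : X * X) : R :=
  if p.1 == p.2 then N p.1 else H (Num.sqrt (mdist p.1 p.2))^-1 p.1.

Lemma lsc_extension_ge0 p : 0 <= lsc_extension p.
Proof.
by rewrite /lsc_extension; case: ifP => // _;
  rewrite inf_conv_ge0// invr_ge0 sqrtr_ge0.
Qed.

Lemma lsc_extension_diagonal : has_diagonal lsc_extension N.
Proof. by move=> x; rewrite /lsc_extension eqxx. Qed.

Hypothesis N_lsc : forall x, \forall z \near x, N x <= N z.

(** The scale [k] is the inverse square root of the distance [d]. Near the diagonal it tends to
    infinity, so that [inf_conv_large] bounds from below, while [k * d] tends to [0], so that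
    testing the infimum at [y] bounds from above. *)
Lemma lsc_extension_continuous : continuous_first lsc_extension.
Proof.
move=> y x; have [->|xy] := eqVneq x y.
  rewrite /continuous_at lsc_extension_diagonal.
  have [K K0 KH] := inf_conv_large (N_lsc y).
  apply: (squeeze_cvgr (f := cst (N y))
    (h := fun z => N y + Num.sqrt (mdist z y))).
  - near=> z; rewrite /lsc_extension/=; case: ifPn => [/eqP ->|zy].
      by rewrite mdistxx sqrtr0 addr0 lexx.
    have zy0 : 0 < Num.sqrt (mdist z y) by rewrite sqrtr_gt0 mdist_gt0.
    apply/andP; split.
      have : forall k, K <= k -> N y <= H k z by near: z.
      apply; rewrite -[K]invrK lef_pV2 ?posrE ?invr_gt0//; near: z.
      have /(cvgr_le 0) : Num.sqrt (mdist z y) @[z --> y] --> 0.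
        rewrite -sqrtr0 -(mdistxx y).
        apply: continuous_comp; [exact: continuous_mdistl|exact: sqrt_continuous].
      by apply; rewrite invr_gt0.
    apply: le_trans (inf_conv_le z y _) _; first by rewrite invr_ge0 ltW.
    by rewrite lerD2l -{2}(sqr_sqrtr (mdist_ge0 z y)) expr2 mulKf// gt_eqF.
  - exact: cvg_cst.
  - rewrite -[X in _ --> X]addr0 -sqrtr0 -(mdistxx y).
    apply: cvgD; first exact: cvg_cst.
    by apply: continuous_comp; [exact: continuous_mdistl|exact: sqrt_continuous].
(* Off the diagonal, replacing the point [z] by [x] costs at most [k z * mdist z x], and only the
   scale is left to vary. *)
pose k z := (Num.sqrt (mdist z y))^-1.
have k0 z : 0 <= k z by rewrite invr_ge0 sqrtr_ge0.
have xy0 : 0 < Num.sqrt (mdist x y) by rewrite sqrtr_gt0 mdist_gt0.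
have kx : k z @[z --> x] --> k x.
  apply: cvgV; first by rewrite gt_eqF.
  by apply: continuous_comp; [exact: continuous_mdistl|exact: sqrt_continuous].
have Hk : H (k z) x @[z --> x] --> H (k x) x.
  apply: (@continuous_comp _ _ _ k (H ^~ x)) => //.
  by apply: inf_conv_continuous_scale; rewrite invr_gt0.
have kd : k z * mdist z x @[z --> x] --> 0.
  rewrite -(mulr0 (k x)) -(mdistxx x); apply: cvgM => //.
  exact: continuous_mdistl.
rewrite /continuous_at /lsc_extension/= (negbTE xy).
apply: (squeeze_cvgr (f := fun z => H (k z) x - k z * mdist z x)
  (h := fun z => H (k z) x + k z * mdist z x)).
- near=> z; have -> : z == y = false.
    apply/negbTE; rewrite -mdist_gt0; near: z.
    have : mdist z y @[z --> x] --> mdist x y by exact: continuous_mdistl.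
    by move=> /cvgr_gt; apply; rewrite mdist_gt0.
  by rewrite lerBlDr {1}(metric_sym z x) !inf_conv_lipschitz.
- by rewrite -[X in _ --> X]subr0; exact: cvgB.
- by rewrite -[X in _ --> X]addr0; exact: cvgD.
Unshelve. all: by end_near. Qed.

(** For fixed [x], the value depends only on the distance to [x], and it is [N x] up to a distance
    [d > 0]. Replacing smaller distances by [d] removes the singularity at the diagonal. *)
Lemma lsc_extension_lipschitz x : exists2 L : R, 0 <= L & forall y z,
  `|lsc_extension (x, y) - lsc_extension (x, z)| <= L * mdist y z.
Proof.
have [K K0 /nbhs_singleton KH] := inf_conv_large (N_lsc x).
(* The positive distances up to [d] are those whose scale is at least [K]. *)
pose d : R := K ^- 2; have d0 : 0 < d by rewrite invr_gt0 exprn_gt0.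
have sqd : Num.sqrt d = K^-1.
  by rewrite /d -exprVn sqrtr_sqr ger0_norm// invr_ge0 ltW.
pose P (s : R) := H (Num.sqrt s)^-1 x.
have Pd y : lsc_extension (x, y) = P (Num.max d (mdist x y)).
  have large s : s <= d -> 0 < s -> P s = N x.
    move=> sd s0; apply/eqP; rewrite eq_le.
    rewrite inf_conv_self ?KH// ?invr_ge0 ?sqrtr_ge0//.
    by rewrite -[K]invrK lef_pV2 ?posrE ?invr_gt0 ?sqrtr_gt0// -sqd ler_sqrt// ltW.
  rewrite /lsc_extension/=; case: ifPn => [/eqP <-|xy].
    by rewrite mdistxx max_l ?large// ltW.
  have [yd|/ltW dy] := leP (mdist x y) d; last by [].
  by rewrite -/(P (mdist x y)) !large// mdist_gt0.
(* The numerator comes from [P (s z) <= N x], the denominator from [d <= s y]. *)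
exists (N x / d) => [|y z]; first by rewrite divr_ge0// ltW.
pose s w := Num.max d (mdist x w).
have sd w : d <= s w by rewrite le_max lexx.
wlog syz : y z / s y <= s z => [wl|].
  by have [/wl//|/ltW/wl] := leP (s y) (s z); rewrite distrC metric_sym.
have sz : s z - s y <= mdist y z.
  rewrite lerBlDr ge_max (le_trans (sd y)) ?lerDr ?mdist_ge0//=.
  rewrite addrC (le_trans (metric_triangle x y z))// lerD2r.
  by rewrite le_max lexx orbT.
have sy0 : 0 < s y by exact: lt_le_trans (sd y).
have sz0 : 0 < s z by exact: lt_le_trans (sd z).
have sqy0 : 0 < Num.sqrt (s y) by rewrite sqrtr_gt0.
have sqz0 : 0 < Num.sqrt (s z) by rewrite sqrtr_gt0.
have sqyz : Num.sqrt (s y) <= Num.sqrt (s z) by rewrite ler_sqrt// ltW.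
have sqV : (Num.sqrt (s z))^-1 <= (Num.sqrt (s y))^-1 by rewrite lef_pV2 ?posrE.
have Pzy : P (s z) <= P (s y) by rewrite inf_conv_mono// invr_ge0 ltW.
have PN : P (s z) <= N x by rewrite inf_conv_self// invr_ge0 ltW.
have P0 : 0 <= P (s z) by rewrite inf_conv_ge0// invr_ge0 ltW.
rewrite !Pd -/(s y) -/(s z) ger0_norm ?subr_ge0//.
have Pyz : P (s y) <= s z / s y * P (s z).
  apply: le_trans (inf_conv_scale x _ sqV) _; first by rewrite invr_gt0.
  (* The quotient of the scales is the square root of [s z / s y >= 1], hence at most
     [s z / s y]. *)
  rewrite ler_wpM2r// invrK [leLHS]mulrC.
  rewrite ler_pdivlMr// -{2}(sqr_sqrtr (ltW sy0)) -{2}(sqr_sqrtr (ltW sz0)).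
  by rewrite !expr2 mulrA divfK ?gt_eqF// ler_wpM2l// ltW.
apply: (@le_trans _ _ ((s z - s y) / s y * P (s z))).
  by rewrite mulrBl mulrBl divff ?gt_eqF// mul1r lerB.
rewrite -mulrA [leRHS]mulrC ler_pM ?subr_ge0//.
  by rewrite mulr_ge0// invr_ge0 ltW.
by rewrite mulrC ler_pM ?invr_ge0 ?lef_pV2// ltW.
Qed.

End inf_conv.

(** * Clamped times and concatenated paths *)

Definition clamp01 (R : realType) (t : R) : R := Num.max 0 (Num.min 1 t).

Lemma clamp01_itv (R : realType) (t : R) : clamp01 t \in `[0, 1].
Proof. by rewrite in_itv/= le_max lexx ge_max ler01 ge_min lexx. Qed.

Lemma clamp01_le0 (R : realType) (t : R) : t <= 0 -> clamp01 t = 0.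
Proof.
by move=> t0; rewrite /clamp01 min_r ?max_l// (le_trans t0).
Qed.

Lemma clamp01_ge1 (R : realType) (t : R) : 1 <= t -> clamp01 t = 1.
Proof. by move=> t1; rewrite /clamp01 min_l// max_r. Qed.

Lemma continuous_clamp01 (R : realType) : continuous (@clamp01 R).
Proof.
move=> t; apply: (@continuous_max _ _ (cst 0) (fun t : R => Num.min 1 t)).
  exact: cvg_cst.
by apply: (@continuous_min _ _ (cst 1) id); [exact: cvg_cst|exact: cvg_id].
Qed.

Lemma clamp01_dist (R : realType) (s t : R) :
  `|clamp01 s - clamp01 t| <= `|s - t|.
Proof.
have clampE (u : R) : clamp01 u = if u <= 0 then 0 else if 1 <= u then 1 else u.
  case: ifPn => [/clamp01_le0//|]; rewrite -ltNge => u0.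
  case: ifPn => [/clamp01_ge1//|]; rewrite -ltNge => u1.
  by rewrite /clamp01 min_r ?max_r// ltW.
have := ler_norm (s - t); have := ler_norm (t - s).
rewrite (distrC t) ler_norml !clampE; move: `|s - t| => d dts dst.
by case: (leP s 0) => ?; case: (leP 1 s) => ?; case: (leP t 0) => ?;
  case: (leP 1 t) => ?; apply/andP; split; lra.
Qed.

(** Clamped times never leave [0, 1], so continuity of [lambda] within the strip is enough. *)
Lemma equiconnected_clamp (R : realType) (Z : metricType R)
    (lambda : Z * Z * R -> Z) :
  equiconnected lambda ->
  continuous (fun p : Z * Z * R => lambda (p.1, clamp01 p.2)).
Proof.
move=> [/subspace_continuousP lc _ _ _] [ab s].
pose h (p : Z * Z * R) : Z * Z * R := (p.1, clamp01 p.2).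
apply: (@cvg_comp _ _ _ h lambda _
  (within ([set: Z * Z] `*` `[0, 1]) (nbhs (h (ab, s))))); last first.
  by apply: lc; split=> //=; have := clamp01_itv s.
have hc : h x @[x --> (ab, s)] --> h (ab, s).
  have h1 : p.1 @[p --> (ab, s)] --> ab by exact: cvg_fst.
  have h2 : clamp01 p.2 @[p --> (ab, s)] --> clamp01 s.
    by apply: continuous_comp; [exact: cvg_snd|exact: continuous_clamp01].
  exact: cvg_pair h1 h2.
move=> U /hc; rewrite /= /nbhs/= => Uh; apply: filterS Uh => p; apply.
by split=> //=; have := clamp01_itv p.2.
Qed.

(* Travels along [lambda] from [g_ k x] to [g_ k.+1 x] for [s] in
   [k, k + 1], [k < n], and stays at [g_ n x] for [n <= s]. *)
Fixpoint chain (R : realType) (X Z : Type) (lambda : Z * Z * R -> Z)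
    (g_ : nat -> X -> Z) (n : nat) (x : X) (s : R) : Z :=
  if n is m.+1
  then lambda (chain lambda g_ m x s, g_ m.+1 x, clamp01 (s - m%:R))
  else g_ 0%N x.

Section chain.
Context (R : realType) (X Z : metricType R) (lambda : Z * Z * R -> Z).
Context (g_ : nat -> X -> Z).
Hypothesis lambdaE : equiconnected lambda.

Local Notation chain := (chain lambda g_).

Lemma chain_end n x s : n%:R <= s -> chain n x s = g_ n x.
Proof.
have [_ _ l1 _] := lambdaE.
by case: n => //= n ns; rewrite clamp01_ge1// lerBrDr addrC natr1.
Qed.

Lemma chainS n x s : s <= n%:R -> chain n.+1 x s = chain n x s.
Proof.
by have [_ l0 _ _] := lambdaE => sn /=; rewrite clamp01_le0// subr_le0.
Qed.

Lemma chain_le m n x s : s <= n%:R -> (n <= m)%N -> chain m x s = chain n x s.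
Proof.
move=> sn; elim: m => [|m IH]; first by rewrite leqn0 => /eqP ->.
rewrite leq_eqVlt ltnS => /predU1P[<-//|nm].
by rewrite chainS ?IH// (le_trans sn)// ler_nat.
Qed.

(** Each segment after [n] joins [g_ n x] to itself, and [lambda (z, z, t) = z] makes it
    constant. *)
Lemma chain_stable m n x s : (forall k, (n <= k)%N -> g_ k x = g_ n x) ->
  (n <= m)%N -> chain m x s = chain n x s.
Proof.
move=> gn; elim: m => [|m IH]; first by rewrite leqn0 => /eqP ->.
rewrite leq_eqVlt ltnS => /predU1P[<-//|nm].
have [sm|/ltW ms] := leP s m%:R; first by rewrite chainS ?IH.
rewrite -IH//= (chain_end x ms) (gn m.+1) ?leqW// gn//.
by have [_ _ _ ->] := lambdaE => //; exact: clamp01_itv.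
Qed.

Lemma continuous_chain n : (forall k, continuous (g_ k)) ->
  continuous (fun p : X * R => chain n p.1 p.2).
Proof.
move=> gc; elim: n => [|n IH] /= p.
  by apply: continuous_comp; [exact: cvg_fst|exact: gc].
pose h (p : X * R) : Z * Z * R := (chain n p.1 p.2, g_ n.+1 p.1, p.2 - n%:R).
apply: (@continuous_comp _ _ _ h (fun p => lambda (p.1, clamp01 p.2))); last first.
  exact: equiconnected_clamp.
have h1 : chain n q.1 q.2 @[q --> p] --> chain n p.1 p.2 by exact: IH.
have h2 : g_ n.+1 q.1 @[q --> p] --> g_ n.+1 p.1.
  by apply: continuous_comp; [exact: cvg_fst|exact: gc].
have h3 : q.2 - n%:R @[q --> p] --> p.2 - n%:R.
  by apply: (@cvgB _ R^o); [exact: cvg_snd|exact: cvg_cst].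
exact: cvg_pair (cvg_pair h1 h2) h3.
Qed.

Lemma lipschitz_chain n x : lipschitz_third lambda ->
  exists2 L : R, 0 <= L &
    forall s t, mdist (chain n x s) (chain n x t) <= L * `|s - t|.
Proof.
move=> lipl; elim: n => [|n [L L0 IH]].
  by exists 0 => // s t; rewrite mdistxx mul0r.
have /lipschitz_withinP[M M0 lM] := lipl (g_ n x) (g_ n.+1 x).
exists (L + M) => [|s t]; first exact: addr_ge0.
wlog st : s t / s <= t => [H|].
  by have [/H//|/ltW/H] := leP s t; rewrite metric_sym distrC.
(* From time [n] on, the start of the last segment is frozen at [g_ n x], so that only the third
   variable of [lambda] moves. *)
have far u v : n%:R <= u -> n%:R <= v ->
    mdist (chain n.+1 x u) (chain n.+1 x v) <= M * `|u - v|.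
  move=> nu nv /=; rewrite !chain_end//.
  apply: le_trans (lM _ _ (clamp01_itv _) (clamp01_itv _)) _.
  rewrite ler_wpM2l// /mdist/= (le_trans (clamp01_dist _ _))//.
  rewrite distrC (_ : u - n%:R - (v - n%:R) = u - v)//; ring.
have [tn|/ltW nt] := leP t n%:R.
  rewrite !chainS ?(le_trans st)// (le_trans (IH _ _))//.
  by rewrite ler_wpM2r// lerDl.
have [sn|/ltW ns] := leP s n%:R; last first.
  by rewrite (le_trans (far _ _ _ _))// ler_wpM2r// lerDr.
apply: le_trans (metric_triangle _ (chain n.+1 x n%:R) _) _.
rewrite mulrDl lerD//.
- rewrite !chainS// (le_trans (IH _ _))// ler_wpM2l//.
  by rewrite !ler0_norm ?subr_le0// !opprB lerB.
- rewrite (le_trans (far _ _ _ _))// ler_wpM2l//.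
  by rewrite !ler0_norm ?subr_le0// !opprB lerB.
Qed.

End chain.

(** * Stationarity index and construction of [f] *)

Lemma lower_semicontinuous_stable_index (R : realType) (X : topologicalType)
    (Z : metricType R) (g_ : nat -> X -> Z) (nu : X -> nat) :
  (forall n, continuous (g_ n)) ->
  (forall x n, (nu x <= n)%N -> g_ n x = g_ (nu x) x) ->
  (forall x m, (forall n, (m <= n)%N -> g_ n x = g_ m x) -> (nu x <= m)%N) ->
  forall x, \forall z \near x, (nu x <= nu z)%N.
Proof.
move=> gc nus numin x; case nux : (nu x) => [|m]; first exact: nearW.
(* By minimality of [nu x = m.+1], some [g_ n] with [m <= n] differs from [g_ m] at [x], hence by
   continuity at all nearby [z], which excludes [nu z <= m]. *)
have [n /not_implyP[mn gnm]] :
    exists n, ~ ((m <= n)%N -> g_ n x = g_ m x).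
  by apply/existsNP => /numin; rewrite nux ltnn.
have e0 : 0 < mdist (g_ n x) (g_ m x) / 2.
  by rewrite divr_gt0// mdist_gt0; exact/eqP.
near=> z; rewrite ltnNge; apply/negP => zm.
suff : mdist (g_ n x) (g_ m x) < mdist (g_ n x) (g_ m x) by rewrite ltxx.
rewrite {2}(splitr (mdist _ _)).
apply: (le_lt_trans (metric_triangle _ (g_ n z) _)); apply: ltrD.
  by near: z; have /cvgrPdist_lt := gc n x; exact.
rewrite (nus _ _ (leq_trans zm mn)) -(nus _ _ zm) metric_sym.
by near: z; have /cvgrPdist_lt := gc m x; exact.
Unshelve. all: by end_near. Qed.

Lemma stable_baire1_extension (R : realType) (X Z : metricType R)
    (lambda : Z * Z * R -> Z) (g : X -> Z) :
  equiconnected lambda -> lipschitz_third lambda -> stable_baire1 g ->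
  exists f : X * X -> Z,
    [/\ has_diagonal f g, continuous_first f & lipschitz_second f].
Proof.
move=> lE l3 [g_ gc gs].
pose stab x m := forall n, (m <= n)%N -> g_ n x = g_ m x.
have /choice[nu nuP] x : exists m, stab x m /\ forall k, stab x k -> (m <= k)%N.
  have ex : exists m, `[< stab x m >].
    (* The inequality in [stable_baire1] is strict, whence [m.+1]. *)
    have [m gm] := gs x; exists m.+1; apply/asboolP => n mn.
    by rewrite !gm.
  exists (ex_minn ex); case: ex_minnP => m /asboolP sm mmin.
  by split=> // k /asboolP; exact: mmin.
have nus x n : (nu x <= n)%N -> g_ n x = g_ (nu x) x by have [+ _] := nuP x; exact.
have gnu x : g_ (nu x) x = g x.
  have [m gm] := gs x; rewrite -(gm (maxn m.+1 (nu x))) ?leq_maxl//.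
  by rewrite nus// leq_maxr.
pose N x : R := (nu x)%:R.
have N0 x : 0 <= N x by [].
have Nlsc x : \forall z \near x, N x <= N z.
  near=> z; rewrite ler_nat; near: z.
  by apply: lower_semicontinuous_stable_index gc nus _ x => y k;
    have [_] := nuP y; exact.
pose phi := lsc_extension N; have phi0 p : 0 <= phi p by exact: lsc_extension_ge0.
pose F x s := chain lambda g_ (Num.truncn s).+1 x s.
(* [FE] has an index independent of [x], for continuity in the first variable; [Fnu] has the index
   [nu x], for the Lipschitz bound and the diagonal. *)
have FE n x s : s <= n%:R -> F x s = chain lambda g_ n x s.
  move=> sn; have sS : s <= (Num.truncn s).+1%:R by rewrite ltW// truncnS_gt.
  have /orP[nS|Sn] := leq_total n (Num.truncn s).+1; first exact: chain_le.
  by apply/esym; exact: chain_le.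
have Fnu x s : F x s = chain lambda g_ (nu x) x s.
  rewrite (@FE (maxn (Num.truncn s).+1 (nu x))); last first.
    rewrite (le_trans (ltW (truncnS_gt _)))// ler_nat leq_maxl//.
  by rewrite (chain_stable lE _ (nus x))// leq_maxr.
exists (fun p => F p.1 (phi p)); split.
- by move=> x; rewrite /= Fnu /phi lsc_extension_diagonal chain_end// gnu.
- move=> y x; have phic : phi (z, y) @[z --> x] --> phi (x, y).
    exact: lsc_extension_continuous.
  (* The bound by [n] is strict, so it persists near [x] and a single chain serves there. *)
  pose n := (Num.truncn (phi (x, y))).+1.
  have phin : phi (x, y) < n%:R by rewrite truncnS_gt.
  rewrite /continuous_at (FE n) ?ltW//.
  have : chain lambda g_ n z (phi (z, y)) @[z --> x] -->
      chain lambda g_ n x (phi (x, y)).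
    have h1 : (z, phi (z, y)) @[z --> x] --> (x, phi (x, y)).
      exact: cvg_pair (@cvg_id _ (nbhs x)) phic.
    apply: (cvg_comp (fun z => (z, phi (z, y)))
      (fun p => chain lambda g_ n p.1 p.2) h1).
    by have := @continuous_chain R X Z lambda g_ lE n gc (x, phi (x, y)); apply.
  apply: cvg_trans; apply: near_eq_cvg; near=> z.
  rewrite (FE n)// ltW//; near: z.
  by move/cvgr_lt : phic; apply.
- move=> x; have [L L0 hL] := lipschitz_chain g_ lE (nu x) x l3.
  have [M M0 hM] := lsc_extension_lipschitz N0 Nlsc x.
  apply/lipschitz_withinP; exists (L * M) => [|y z _ _]; first exact: mulr_ge0.
  by rewrite /= !Fnu (le_trans (hL _ _))// -mulrA ler_wpM2l.
Unshelve. all: by end_near. Qed.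

Theorem theorem5p5 (R : realType) (X Z : metricType R)
    (lambda : Z * Z * R -> Z) (g : X -> Z) :
  equiconnected lambda ->
  lipschitz_third lambda ->
  absolute_extensor Z X ->
  [<-> stable_baire1 g;
       exists f : X * X -> Z,
         [/\ has_diagonal f g, continuous_first f & lipschitz_second f];
       exists f : X * X -> Z,
         [/\ has_diagonal f g, continuous_first f &
             lipschitz_second_at_diagonal f]].
Proof.
move=> lE l3 ae; tfae.
- exact: stable_baire1_extension lE l3.
- move=> [f [fg fc fl]]; exists f; split=> // x; have [M ubM] := fl x.
  by exists M => _ [y [yx ->]]; apply: ubM; exists x, y; split=> // xy; exact: yx.
- by move=> [f [fg fc fl]]; exact: stable_baire1_diagonal fg fc fl.
Qed.
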